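(* Let $G$ be a Polish group, let $X$ be a Polish $G$-space and let $B\subseteq X$ be a $G$-invariant Borel set. Then there is a Polish topology on $X$, finer than the given topology of $X$ (and thus having the same Borel structure), in which $B$ is clopen and for which the action of $G$ on $X$ is still continuous.
   Context: A Polish space (group) is a separable, completely metrizable topological space (group). For a Polish group $G$, a Polish $G$-space is a Polish space $X$ together with an action $G\times X\to X$, $(g,x)\mapsto g\cdot x$, which is (jointly) continuous. A set $B\subseteq X$ is invariant if $g\cdot x\in B$ for all $g\in G$, $x\in B$. ''Finer'' means containing all open sets of the original topology (not necessarily strictly more). *)

(* Defs.v *)
From HB Require Import structures.
From mathcomp Require Import all_boot all_order all_algebra.
From mathcomp Require Import all_classical all_reals all_analysis.

Set Implicit Arguments.
Unset Strict Implicit.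
Unset Printing Implicit Defensive.

Local Open Scope classical_set_scope.

(* Multiplicative, possibly non-commutative counterpart of the library's
   TopologicalZmodule. *)
HB.structure Definition PreTopologicalGroup :=
  {G of Topological G & Group G}.

HB.mixin Record PreTopologicalGroup_isTopologicalGroup G
    & PreTopologicalGroup G := {
  mulg_continuous : continuous (fun p : G * G => (p.1 * p.2)%g) ;
  invg_continuous : continuous (fun g : G => (g^-1)%g)
}.

#[short(type="topologicalGroupType")]
HB.structure Definition TopologicalGroup :=
  {G of PreTopologicalGroup G & PreTopologicalGroup_isTopologicalGroup G}.

Definition separable (T : topologicalType) : Prop :=
  exists2 D : set T, countable D & dense D.

(* The library's completeType is pointed, which would exclude the empty
   space; hence completeness is spelled out with Cauchy sequences. *)
Definition complete_metric (R : realType) (M : metricType R) : Prop :=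
  forall u : nat -> M, cauchy (u @ \oo) -> exists l : M, u @ \oo --> l.

(* A metric compatible with the topology of T is a metric structure on the
   carrier of T whose induced topology has the same open sets. *)
Definition completely_metrizable (R : realType) (T : topologicalType) : Prop :=
  exists m : Metric.axioms_ R T,
    let M : metricType R := Metric.Pack m in
    (forall U : set T, @open M U <-> @open T U) /\ complete_metric M.

Definition polish (R : realType) (T : topologicalType) : Prop :=
  separable T /\ completely_metrizable R T.

Record polish_Gspace (R : realType) (G : topologicalGroupType)
    (X : topologicalType) (act : G -> X -> X) : Prop := PolishGspace {
  Gspace_polish : polish R X ;
  Gspace_act1 : forall x, act 1%g x = x ;
  Gspace_actM : forall g h x, act (g * h)%g x = act g (act h x) ;
  Gspace_continuous : continuous (fun p : G * X => act p.1 p.2)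
}.

Definition borel (T : topologicalType) : set (set T) := <<s @open T >>.
Arguments borel : clear implicits.

Definition invariant_set (G X : Type) (act : G -> X -> X) (B : set X) : Prop :=
  forall g x, B x -> B (act g x).

(* Main.v *)
(* For B a subset of X and U open in G, the Vaught transform of B by U is the
   set of all x such that {g in U | g x in B} is nonmeager. Call B
   topologizable if some finer Polish topology with continuous action makes all
   Vaught transforms of B open. An invariant B is its own transform by U = G,
   so it suffices that every Borel set is topologizable. Open sets are, and
   countable unions are handled by joining countably many topologies. For
   complements, fix a right-invariant compatible pseudometric on G and let
   f x g be the distance, truncated at 1, from g to the set where
   {h | h x in B} is locally nonmeager. Then x |-> f x g is upper
   semicontinuous because the transforms of B are open; f x is 1-Lipschitz and
   f (h x) g = f x (g h), so making the functions f _ g continuous, for g in a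
   countable dense set, keeps the action continuous; and the transform of the
   complement by U is the union over g in U of the sets {x | f x g > 0}, by the
   Baire property of {h | h x in B}. The refined topology is Polish since the
   graph of an upper semicontinuous function is a G_delta set.

   Topologies are represented by pseudometrics d : X -> X -> R. Separability
   is replaced by countable covers of small diameter whose members lie in a
   sigma-algebra S, here the Borel sets, which shows at the same time that no
   new Borel sets appear. *)

Require Import Defs.
From HB Require Import structures.
From mathcomp Require Import all_boot all_order all_algebra.
From mathcomp Require Import all_classical all_reals all_analysis.
From mathcomp Require Import lra.

Set Implicit Arguments.
Unset Strict Implicit.
Unset Printing Implicit Defensive.

Import Order.TTheory GRing.Theory Num.Theory.
Import numFieldNormedType.Exports.

Local Open Scope classical_set_scope.

(** * Pseudometrics and their countable suprema *)

Section pseudometrics.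
Local Open Scope ring_scope.
Context {R : realType} {X : Type}.
Implicit Types (d : X -> X -> R) (S : set (set X)).

Definition pmetric d := [/\ forall x, d x x = 0, forall x y, d x y = d y x
  & forall x y z, d x z <= d x y + d y z].

Definition dball d (x : X) : set_system X :=
  filter_from (fun e : R => 0 < e) (fun e => [set y | d x y < e]).

Definition dopen d (U : set X) := forall x, U x -> dball d x U.

Definition dcauchy d (u : nat -> X) := forall e, 0 < e ->
  \forall p \near (\oo, \oo), d (u p.1) (u p.2) < e.

Definition dcvg d (u : nat -> X) (l : X) := forall e, 0 < e ->
  \forall n \near \oo, d l (u n) < e.

Definition dcomplete d := forall u, dcauchy d u -> exists l, dcvg d u l.

(** A countable partition into sets of [S] is encoded by the index [c] of the piece, so that
    partitions are intersected by pairing indices. *)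
Definition dcovered S d := forall e, 0 < e -> exists c : X -> nat,
  (forall n, S [set x | c x = n]) /\ (forall x y, c x = c y -> d x y < e).

Definition dfun (h : X -> R) (x y : X) := `|h x - h y|.

Lemma pmetric_ge0 d x y : pmetric d -> 0 <= d x y.
Proof.
move=> [d0 ds dt]; have := dt x y x; rewrite d0 (ds y x); lra.
Qed.

Lemma pmetric_dfun h : pmetric (dfun h).
Proof.
split=> [x|x y|x y z]; rewrite /dfun; first by rewrite subrr normr0.
  exact: distrC.
exact: ler_distD.
Qed.

Lemma dball_filter d x : pmetric d -> Filter (dball d x).
Proof.
move=> dm; apply: filter_from_filter; first by exists 1.
move=> i j i0 j0; exists (Num.min i j); first by rewrite lt_min i0.
by move=> y /=; rewrite lt_min => /andP[].
Qed.

Lemma dball_near d x e : 0 < e -> \forall y \near dball d x, d x y < e.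
Proof. by move=> e0; exists e. Qed.

Lemma dball_open d x e : pmetric d -> dopen d [set y | d x y < e].
Proof.
move=> [d0 ds dt] y /= xy; exists (e - d x y); first by rewrite /= subr_gt0.
by move=> z /= yz; have := dt x y z; lra.
Qed.

Lemma dcvg_unique d u l m : pmetric d -> (forall x y, d x y = 0 -> x = y) ->
  dcvg d u l -> dcvg d u m -> l = m.
Proof.
move=> dm dsep ul um; apply: dsep; apply/eqP; rewrite eq_le pmetric_ge0// andbT.
apply/ler_addgt0Pr => e e0; rewrite add0r.
have e2 : 0 < e / 2 by lra.
have [n [lt mt]] : exists n, d l (u n) < e / 2 /\ d m (u n) < e / 2.
  by apply: (@filter_ex _ \oo); apply: filterI; [exact: ul|exact: um].
case: dm => d0 ds dt; have := dt l (u n) m; rewrite (ds (u n)); lra.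
Qed.

(** [U] is the union of all pieces contained in it, taken over the partitions of mesh
    [1 / (j + 1)]. *)
Lemma dopen_covered S d U : pmetric d ->
  (forall F : (set X)^nat, (forall n, S (F n)) -> S (\bigcup_n F n)) ->
  S set0 -> dcovered S d -> dopen d U -> S U.
Proof.
move=> dm Sbig S0 cov Uo.
have /choice[c cP] : forall j : nat, exists c : X -> nat,
    (forall n, S [set x | c x = n]) /\
    (forall x y, c x = c y -> d x y < j.+1%:R^-1).
  by move=> j; apply: cov.
pose F j n := if pselect ([set x | c j x = n] `<=` U)
  then [set x | c j x = n] else set0.
suff -> : U = \bigcup_j \bigcup_n F j n.
  have SF j n : S (F j n).
    by rewrite /F; case: pselect => /= _ //; case: (cP j) => + _; apply.
  by apply: (Sbig) => j; apply: (Sbig).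
apply/seteqP; split=> [x Ux|x [j _ [n _]]]; last first.
  by rewrite /F; case: pselect => // sub /sub.
have [e e0 eU] := Uo _ Ux.
have [j je] : exists j : nat, j.+1%:R^-1 < e.
  exists (Num.truncn e^-1).
  by rewrite -ltf_pV2 ?(posrE,divr_gt0)// invrK truncnS_gt.
exists j => //; exists (c j x) => //; rewrite /F; case: pselect => // -[] y /= yx.
by apply: eU => /=; apply: lt_trans je; case: (cP j) => _; apply.
Qed.

End pseudometrics.

(** * Suprema of sequences of truncated pseudometrics *)

Section combine.
Local Open Scope ring_scope.
Context {R : realType} {X : Type}.
Variable D : nat -> X -> X -> R.
Hypothesis Dm : forall n, pmetric (D n).

(** Because of the truncation at [1 / (n + 1)], a bound [e > 0] on the supremum concerns only
    finitely many [D n]. *)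
Let m n x y : R := Num.min (D n x y) n.+1%:R^-1.

Definition dsup x y : R := sup [set m n x y | n in setT].

Let m_le1 n x y : m n x y <= 1.
Proof. by rewrite ge_min orbC invf_le1 ?ler1n. Qed.

Let le_dsup n x y : m n x y <= dsup x y.
Proof.
by apply: ub_le_sup; [exists 1 => _ [k _ <-]|exists n].
Qed.

Let dsup_le x y (e : R) : (forall n, m n x y <= e) -> dsup x y <= e.
Proof.
move=> h; apply: ge_sup; first by exists (m 0 x y), 0%N.
by move=> _ [n _ <-].
Qed.

Lemma dsup_lt n x y : dsup x y < n.+1%:R^-1 -> D n x y <= dsup x y.
Proof.
by move=> h; have := le_dsup n x y; rewrite ge_min => /orP[//|]; rewrite leNgt h.
Qed.

Lemma dsup_le_small (N : nat) x y (e : R) : N.+1%:R^-1 <= e ->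
  (forall n, (n < N)%N -> D n x y <= e) -> dsup x y <= e.
Proof.
move=> Ne h; apply: dsup_le => n; rewrite ge_min.
have [/h->//|Nn] := ltnP n N; apply/orP; right; apply: le_trans Ne.
by rewrite lef_pV2 ?posrE// ler_nat.
Qed.

Lemma pmetric_dsup : pmetric dsup.
Proof.
split=> [x|x y|x y z].
- apply/eqP; rewrite eq_le; apply/andP; split.
    by apply: dsup_le => n; rewrite /m ge_min; case: (Dm n) => ->; rewrite lexx.
  apply: le_trans (le_dsup 0 x x); rewrite /m le_min.
  by case: (Dm 0) => -> _ _; rewrite lexx invr_ge0 ler0n.
- by congr sup; apply/seteqP; split => _ [n _ <-]; exists n => //;
    rewrite /m; case: (Dm n) => _ -> _.
- apply: dsup_le => n; apply: le_trans (lerD (le_dsup n x y) (le_dsup n y z)).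
  case: (Dm n) => _ _ /(_ x y z).
  have := pmetric_ge0 x y (Dm n); have := pmetric_ge0 y z (Dm n).
  have : 0 <= n.+1%:R^-1 :> R by rewrite invr_ge0 ler0n.
  rewrite /m; move: (_ ^-1) => v v0 yz0 xy0 xyz.
  have [_|_] := leP (D n x y) v; have [_|_] := leP (D n y z) v;
    by rewrite ge_min; apply/orP; (left; lra) || (right; lra).
Qed.

(** Stated for two maps along an arbitrary filter, this and its converse serve Cauchy sequences,
    limits and the continuity of the action alike. *)
Lemma near_dsup {T : Type} {F : set_system T} {FF : Filter F} (a b : T -> X) :
  (forall n e, 0 < e -> \forall t \near F, D n (a t) (b t) < e) ->
  forall e, 0 < e -> \forall t \near F, dsup (a t) (b t) < e.
Proof.
move=> h e e0.
have [N Ne] : exists N : nat, N.+1%:R^-1 < e / 2.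
  exists (Num.truncn (e / 2)^-1).
  by rewrite -ltf_pV2 ?(posrE,divr_gt0)// invrK truncnS_gt.
have : \forall t \near F, forall n, (n < N)%N -> D n (a t) (b t) <= e / 2.
  elim: N {Ne} => [|N IH]; first by near=> t.
  have hN : \forall t \near F, D N (a t) (b t) < e / 2 by apply: h; lra.
  near=> t => n; rewrite ltnS leq_eqVlt => /orP[/eqP ->|nN].
    by apply: ltW; near: t.
  by move: n nN; near: t.
apply: filterS => t ht; apply: (@le_lt_trans _ _ (e / 2)); last lra.
by apply: dsup_le_small ht; exact: ltW.
Unshelve. all: by end_near. Qed.

Lemma near_of_dsup {T : Type} {F : set_system T} {FF : Filter F} (a b : T -> X) :
  (forall e, 0 < e -> \forall t \near F, dsup (a t) (b t) < e) ->
  forall n e, 0 < e -> \forall t \near F, D n (a t) (b t) < e.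
Proof.
move=> h n e e0.
have k0 : 0 < Num.min e n.+1%:R^-1 :> R by rewrite lt_min e0 invr_gt0 ltr0n.
apply: filterS (h _ k0) => t; rewrite lt_min => /andP[te tn].
exact: le_lt_trans (dsup_lt tn) te.
Qed.

Lemma dcauchy_dsup u : dcauchy dsup u -> forall n, dcauchy (D n) u.
Proof. move=> cu n e e0.
by apply: (@near_of_dsup _ _ _ (fun p => u p.1) (fun p => u p.2) cu). Qed.

(** Terms of index at least [N] are below [e / 2] by truncation; the common refinement of the
    partitions for the other terms suffices. *)
Lemma dcovered_dsup S : S setT -> (forall A B, S A -> S B -> S (A `&` B)) ->
  S set0 -> (forall n, dcovered S (D n)) -> dcovered S dsup.
Proof.
move=> ST SI S0 cov e e0.
have [N Ne] : exists N : nat, N.+1%:R^-1 < e / 2.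
  exists (Num.truncn (e / 2)^-1).
  by rewrite -ltf_pV2 ?(posrE,divr_gt0)// invrK truncnS_gt.
suff [c [Sc cP]] : exists c : X -> nat, (forall n, S [set x | c x = n]) /\
    (forall x y, c x = c y -> forall n, (n < N)%N -> D n x y <= e / 2).
  exists c; split=> // x y /cP h; apply: (@le_lt_trans _ _ (e / 2)); last lra.
  by apply: dsup_le_small h; exact: ltW.
elim: N {Ne} => [|N [c [Sc cP]]].
  exists (fun=> 0%N); split=> // n; have [->|n0] := eqVneq n 0%N.
    by rewrite (_ : [set _ | _] = setT)//; apply/seteqP.
  rewrite (_ : [set _ | _] = set0)//; apply/seteqP; split=> // x /= /esym/eqP.
  by rewrite (negbTE n0).
have [c' [Sc' c'P]] := cov N (e / 2) ltac:(lra).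
exists (fun x => pickle (c x, c' x)); split=> [k|x y]; last first.
  move=> /(pcan_inj pickleK)[cxy c'xy] n; rewrite ltnS leq_eqVlt => /orP[/eqP->|].
    by apply: ltW; exact: c'P.
  exact: cP.
have [[[i j] ijk]|nk] := pselect (exists p : nat * nat, pickle p = k).
  rewrite (_ : [set _ | _] = [set x | c x = i] `&` [set x | c' x = j]).
    exact: SI.
  apply/seteqP; split=> x /=; first by rewrite -ijk => /(pcan_inj pickleK)[].
  by move=> [-> ->].
rewrite (_ : [set _ | _] = set0)//; apply/seteqP; split=> // x /= xk.
by apply: nk; exists (c x, c' x).
Qed.

End combine.

(** * Refining a Polish metric *)

Section polish_metrics.
Local Open Scope ring_scope.
Context {R : realType} {X : Type} (S : set (set X)).
Hypothesis Ssigma : sigma_algebra setT S.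
Implicit Types d : X -> X -> R.

Let S0 : S set0. Proof. by case: Ssigma. Qed.

Let SC A : S A -> S (~` A).
Proof. by case: Ssigma => _ + _ => /[apply]; rewrite setTD. Qed.

Let SU (F : (set X)^nat) : (forall n, S (F n)) -> S (\bigcup_n F n).
Proof. by case: Ssigma => _ _; apply. Qed.

Let ST : S setT. Proof. by rewrite -setC0; exact: SC. Qed.

Let SI A B : S A -> S B -> S (A `&` B).
Proof.
move=> SA SB; rewrite -[A `&` B]setCK setCI -bigcup2E; apply/SC/SU => n.
by rewrite /bigcup2; case: n => [|[|n]] //; exact: SC.
Qed.

Record polish_metric d : Prop := PolishMetric {
  polish_pmetric : pmetric d ;
  polish_sep : forall x y, d x y = 0 -> x = y ;
  polish_complete : dcomplete d ;
  polish_covered : dcovered S d }.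

Lemma polish_open d U : polish_metric d -> dopen d U -> S U.
Proof. by case=> ? _ _ ?; exact: dopen_covered. Qed.

(** The sets [A n] are made disjoint by sending each point to the least [n] with [A n x]. *)
Lemma dcovered_of_sets d : (forall e, 0 < e -> exists A : nat -> set X,
    [/\ forall n, S (A n), forall x, exists n, A n x &
      forall n x y, A n x -> A n y -> d x y < e]) -> dcovered S d.
Proof.
move=> h e e0; have [A [SA Acov Ad]] := h e e0.
have ex x : exists n, `[< A n x >] by have [n /asboolP] := Acov x; exists n.
exists (fun x => ex_minn (ex x)); split=> [n|x y]; last first.
  by case: ex_minnP => m /asboolP Amx _; case: ex_minnP => k /asboolP Aky _ /esym mk;
    apply: (Ad m) => //; rewrite -mk.
rewrite (_ : [set _ | _] =
    A n `&` ~` \bigcup_m (if (m < n)%N then A m else set0)).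
  by apply: SI => //; apply/SC/SU => m; case: ifP.
apply/seteqP; split=> x /=.
  case: ex_minnP => m /asboolP Amx minm <-; split=> // -[k _].
  by case: ifPn => // km Akx; have := minm k (asboolT Akx); rewrite leqNgt km.
case: ex_minnP => m /asboolP Amx minm [Anx nA]; apply/eqP; rewrite eqn_leq.
rewrite minm ?(asboolT Anx)//= leqNgt; apply/negP => mn.
by apply: nA; exists m => //; rewrite mn.
Qed.

(** The pieces [k e <= h < (k + 1) e] are differences of two sublevel sets. *)
Lemma dcovered_dfun (h : X -> R) : (forall x, 0 <= h x) ->
  (forall r, S [set x | h x < r]) -> dcovered S (dfun h).
Proof.
move=> h0 Sh e e0; exists (fun x => Num.truncn (h x / e)).
have bnd x : (Num.truncn (h x / e))%:R * e <= h x
    < (Num.truncn (h x / e))%:R * e + e.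
  rewrite -ler_pdivlMr// -[X in _ + X]mul1r -mulrDl -ltr_pdivrMr// natr1.
  by apply: truncn_itv; rewrite divr_ge0// ltW.
split=> [n|x y xy]; last first.
  rewrite /dfun ltr_norml; have := bnd x; have := bnd y; rewrite xy; lra.
rewrite (_ : [set _ | _] =
    [set x | h x < n%:R * e + e] `&` ~` [set x | h x < n%:R * e]).
  by apply: SI; [|apply: SC]; exact: Sh.
apply/seteqP; split=> x /=; first by have := bnd x => + <-; lra.
rewrite -[X in _ * e + X]mul1r -mulrDl => -[+ /negP]; rewrite -leNgt natr1.
rewrite -ltr_pdivrMr// -ler_pdivlMr// => hi lo; apply/eqP.
by rewrite truncn_eq ?lo ?hi// divr_ge0// ltW.
Qed.

(** The [dsup] of this sequence induces the coarsest refinement of the topology of [d] that makes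
    every [h k] continuous. *)
Definition with_functions d (h : nat -> X -> R) n :=
  if n is k.+1 then dfun (h k) else d.

Lemma with_functions_pmetric d h n : pmetric d -> pmetric (with_functions d h n).
Proof. by case: n => //= n _; exact: pmetric_dfun. Qed.

Lemma dcauchy_with_functions d h u :
  dcauchy (dsup (with_functions d h)) u ->
  dcauchy d u /\ forall k, dcauchy (dfun (h k)) u.
Proof.
by move=> /dcauchy_dsup cu; split=> [|k]; [exact: (cu 0%N)|exact: (cu k.+1)].
Qed.

Lemma near_with_functions {T : Type} {F : set_system T} {FF : Filter F}
    d h (a b : T -> X) :
  (forall e, 0 < e -> \forall t \near F, d (a t) (b t) < e) ->
  (forall k e, 0 < e -> \forall t \near F, `|h k (a t) - h k (b t)| < e) ->
  forall e, 0 < e -> \forall t \near F, dsup (with_functions d h) (a t) (b t) < e.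
Proof.
move=> Fd Fh; by apply: near_dsup => -[|n] //=; exact: Fh.
Qed.

Lemma near_of_with_functions {T : Type} {F : set_system T} {FF : Filter F}
    d h (a b : T -> X) :
  (forall e, 0 < e -> \forall t \near F, dsup (with_functions d h) (a t) (b t) < e) ->
  (forall e, 0 < e -> \forall t \near F, d (a t) (b t) < e) /\
  (forall k e, 0 < e -> \forall t \near F, `|h k (a t) - h k (b t)| < e).
Proof.
move=> Fd; have Fd' := @near_of_dsup _ _ _ _ F FF _ _ Fd.
by split=> [|k]; [exact: (Fd' 0%N)|exact: (Fd' k.+1)].
Qed.

(** * Making upper semicontinuous functions continuous *)

Section refinement.
Variables (d : X -> X -> R) (f : nat -> X -> R).
Hypotheses (dP : polish_metric d) (f0 : forall k x, 0 <= f k x).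
Hypothesis fusc : forall k r, dopen d [set x | f k x < r].

Let dm := polish_pmetric dP.
Let dge0 x y : 0 <= d x y := pmetric_ge0 x y dm.
Let dxx x : d x x = 0. Proof. by case: dm. Qed.

(* The distance in the maximum metric of [X * R] from [(x, f x)] to the
   complement of the open set [{(y, t) | f y < t + e}]. *)
Let rho (g : X -> R) (e : R) (x : X) : R :=
  inf [set Num.max (d x y) (g x + e - g y) | y in setT].

Let rho_le g e x y : rho g e x <= Num.max (d x y) (g x + e - g y).
Proof.
apply: ge_inf; last by exists y.
by exists 0 => _ [z _ <-]; rewrite le_max dge0.
Qed.

Let le_rho g e x r :
  (forall y, r <= Num.max (d x y) (g x + e - g y)) -> r <= rho g e x.
Proof.
move=> h; apply: lb_le_inf; first by exists (Num.max (d x x) (g x + e - g x)), x.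
by move=> _ [y _ <-].
Qed.

Let rho_lt g e x r : rho g e x < r ->
  exists y, d x y < r /\ g x + e - g y < r.
Proof.
move=> xr; apply: contrapT => /forallNP h; move: xr; apply/negP; rewrite -leNgt.
apply: le_rho => y; rewrite leNgt gt_max; apply/negP => /andP[? ?].
exact: (h y).
Qed.

(** Upper semicontinuity gives [f k y < f k x + e / 2] for [y] near [x], so the second term of the
    maximum exceeds [e / 2] there; away from [x] the first term is bounded below. *)
Let rho_gt0 k e x : 0 < e -> 0 < rho (f k) e x.
Proof.
move=> e0; have [s s0 sf] := @fusc k (f k x + e / 2) x ltac:(rewrite /=; lra).
apply: (@lt_le_trans _ _ (Num.min s (e / 2))).
  by rewrite lt_min s0/=; lra.
apply: le_rho => y; rewrite ge_min !le_max; have [/sf /= fy|//] := ltP (d x y) s.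
by apply/orP; right; apply/orP; right; lra.
Qed.

Let rho_lip g e x y : rho g e y <= rho g e x + (d x y + `|g x - g y|).
Proof.
rewrite -lerBlDr; apply: le_rho => z; rewrite lerBlDr.
apply: le_trans (rho_le _ _ _ z) _; rewrite ge_max.
case: dm => _ ds dt; have := dt y x z; rewrite (ds y x).
have := ler_norm (g y - g x); rewrite distrC.
have : d x z <= Num.max (d x z) (g x + e - g z) by rewrite le_max lexx.
have : g x + e - g z <= Num.max (d x z) (g x + e - g z).
  by rewrite le_max lexx orbT.
have := dge0 x y; have := normr_ge0 (g x - g y).
by move: (Num.max _ _) => M; move=> *; apply/andP; split; lra.
Qed.

(** For a fixed witness [y] of [rho < r], both inequalities persist near [x], the second by upper
    semicontinuity of [f k]. *)
Let rho_open k e r : dopen d [set x | rho (f k) e x < r].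
Proof.
move=> x /rho_lt[y [xy fxy]]; have := dball_filter x dm => ?.
have dyx : d y x < r by case: dm => _ -> _.
have fx : f k x < r - e + f k y by lra.
have A : dball d x [set z | d y z < r] by exact: dball_open.
have B : dball d x [set z | f k z < r - e + f k y] by exact: fusc.
apply: filterS (filterI A B) => z /= [yz fz].
case: dm => _ ds _; apply: le_lt_trans (rho_le _ _ _ y) _.
by rewrite gt_max ds yz /=; lra.
Qed.

Let inv_rho_measurable k e r : 0 < e -> S [set x | (rho (f k) e x)^-1 < r].
Proof.
move=> e0; have [r0|r0] := leP r 0.
  rewrite (_ : [set _ | _] = set0)//; apply/seteqP; split=> // x /=.
  by have := rho_gt0 k x e0; rewrite -invr_gt0; lra.
(* [1 / rho < r] means [rho > 1 / r], and [rho <= 1 / r] is a countable intersection of open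
   conditions. *)
rewrite (_ : [set _ | _] = ~` \bigcap_n [set x | rho (f k) e x < r^-1 + n.+1%:R^-1]).
  apply: SC; rewrite -[\bigcap__ _]setCK setC_bigcap; apply/SC/SU => n; apply: SC.
  exact: polish_open dP (@rho_open k e _).
apply/seteqP; split=> x /=; have := rho_gt0 k x e0 => rx0.
  rewrite -[r in _ < r]invrK ltf_pV2 ?posrE ?invr_gt0// => h.
  have [n nh] : exists n : nat, n.+1%:R^-1 < rho (f k) e x - r^-1.
    exists (Num.truncn (rho (f k) e x - r^-1)^-1).
    by rewrite -ltf_pV2 ?(posrE,divr_gt0)// ?invrK ?truncnS_gt// ?invr_gt0 subr_gt0.
  by move=> /(_ n I) /=; apply/negP; rewrite -leNgt -lerBrDl ltW.
apply: contra_notP => /negP; rewrite -leNgt -[r in r <= _]invrK.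
rewrite lef_pV2 ?posrE ?invr_gt0// => h n _ /=.
by rewrite (le_lt_trans h)// ltrDl invr_gt0.
Qed.

(** [n] codes a pair [(k, i)], standing for [f k] and [e = 1 / (i + 1)]; numbers coding no pair
    repeat [(0, 0)]. Adding the inverse distance to the complement as a coordinate is the usual way
    to make an open subset of a complete space complete. *)
Let h n x : R := let ki := odflt (0, 0)%N (unpickle n) in
  (rho (f ki.1) ki.2.+1%:R^-1 x)^-1.

Let d1 := dsup (with_functions d f).
Let d1m : pmetric d1.
Proof. by apply: pmetric_dsup => n; exact: with_functions_pmetric. Qed.

Let d2 := dsup (with_functions d1 h).
Let d2m : pmetric d2.
Proof. by apply: pmetric_dsup => n; exact: with_functions_pmetric. Qed.

(** [rho] is positive and Lipschitz in [d] and [f k] together, so its inverse is already continuous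
    for [d1]: passing to [d2] gains completeness without changing the topology. *)
Let near_h {T : Type} {F : set_system T} {FF : Filter F} (a : T -> X) x k :
  (forall e, 0 < e -> \forall t \near F, d1 x (a t) < e) ->
  forall e, 0 < e -> \forall t \near F, `|h k x - h k (a t)| < e.
Proof.
move=> Fd1; have [Fd Ff] := @near_of_with_functions _ F FF _ _ _ _ Fd1.
rewrite /h; case: (odflt _ _) => {}k i /= e e0.
set s : R := i.+1%:R^-1.
suff : rho (f k) s (a t) @[t --> F] --> rho (f k) s x.
  have x0 : rho (f k) s x != 0 by apply/lt0r_neq0/rho_gt0; rewrite /s.
  move=> cv; have : (rho (f k) s (a t))^-1 @[t --> F] --> (rho (f k) s x)^-1.
    exact: cvgV.
  by move/cvgrPdist_lt => /(_ e e0).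
apply/cvgrPdist_lt => /= {}e {}e0.
have e2 : 0 < e / 2 by lra.
apply: filterS (filterI (Fd _ e2) (Ff k _ e2)) => t [dt ft].
have := rho_lip (f k) s x (a t); have := rho_lip (f k) s (a t) x.
case: dm => _ ds _; rewrite (distrC (f k (a t))) (ds (a t)) => A B.
by rewrite ltr_norml; apply/andP; split; lra.
Qed.

Let near_d2 {T : Type} {F : set_system T} {FF : Filter F} (a : T -> X) x :
  (forall e, 0 < e -> \forall t \near F, d x (a t) < e) ->
  (forall k e, 0 < e -> \forall t \near F, `|f k x - f k (a t)| < e) ->
  forall e, 0 < e -> \forall t \near F, d2 x (a t) < e.
Proof.
move=> Fd Ff.
have Fd1 : forall e, 0 < e -> \forall t \near F, d1 x (a t) < e.
  exact: (@near_with_functions _ F FF d f (fun=> x)).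
apply: (@near_with_functions _ F FF d1 h (fun=> x)) => //.
by move=> k; exact: near_h.
Qed.

(* If [u n] tends to [l] in [d] while [f k (u n)] stays below [f k l], then
   [rho] tends to [0] along [u], so [1 / rho] cannot be Cauchy. *)
Let complete_d2 : dcomplete d2.
Proof.
move=> u /dcauchy_with_functions[/dcauchy_with_functions[cd cf] ch].
have [l ul] := polish_complete dP cd.
exists l; apply: near_d2 => // k e e0.
have e4 : 0 < e / 4 by lra.
have cfe := cf k _ e4.
have flt : \forall n \near \oo, f k (u n) < f k l + e.
  have [s s0 sf] := @fusc k (f k l + e) l ltac:(rewrite /=; lra).
  by apply: filterS (ul _ s0) => n /sf.
suff fgt : \forall n \near \oo, f k l - e < f k (u n).
  by apply: filterS (filterI flt fgt) => n [? ?]; rewrite ltr_norml; lra.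
apply: contrapT => nfgt.
(* If some late [f k (u n)] exceeded [f k l - e / 2], the Cauchy bound [e / 4] would keep all later
   ones above [f k l - e], against [nfgt]. *)
have low : \forall n \near \oo, f k (u n) <= f k l - e / 2.
  have [[A B] /= [[N _ NA] [M _ MB]] AB] := cfe.
  near=> n; rewrite leNgt; apply/negP => fn; apply: nfgt.
  exists M => // m Mm.
  have Nn : (N <= n)%N by near: n; exact: nbhs_infty_ge.
  have := AB (n, m) (conj (NA n Nn) (MB m Mm)).
  by rewrite /dfun ltr_norml; lra.
have [i ie] : exists i : nat, i.+1%:R^-1 < e / 2.
  exists (Num.truncn (e / 2)^-1).
  by rewrite -ltf_pV2 ?(posrE,divr_gt0)// ?invrK ?truncnS_gt//; lra.
have hE x : h (pickle (k, i)) x = (rho (f k) i.+1%:R^-1 x)^-1.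
  by rewrite /h pickleK.
have := ch (pickle (k, i)) 1 ltr01.
move=> [[A B] /= [[N _ NA] [M _ MB]] AB].
(* On a tail of [u] the inverse of [rho] is below [c], so [rho > 1 / c]. Testing [rho] at the point
   [l] contradicts this: [d (u n) l] is eventually below [1 / c] and
   [f k (u n) + 1 / (i + 1) - f k l] is nonpositive. *)
pose c := h (pickle (k, i)) (u N) + 1.
have c0 : 0 < c.
  have := @rho_gt0 k i.+1%:R^-1 (u N) (ltac:(by [])).
  by rewrite /c hE -invr_gt0; lra.
have cV0 : 0 < c^-1 by rewrite invr_gt0.
have : \forall n \near \oo, False; last by move=> /filter_ex[].
near=> n.
have Mn : (M <= n)%N by near: n; exact: nbhs_infty_ge.
have := AB (N, n) (conj (NA N (leqnn N)) (MB n Mn)).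
rewrite /dfun ltr_norml => /andP[hn _].
have {}hn : h (pickle (k, i)) (u n) < c by rewrite /c; lra.
have r0 := @rho_gt0 k i.+1%:R^-1 (u n) (ltac:(by [])).
move: hn; rewrite hE -[c]invrK ltf_pV2 ?posrE// => hn.
have ln : d l (u n) < c^-1 by near: n; exact: ul.
have fn : f k (u n) <= f k l - e / 2 by near: n.
have := lt_le_trans hn (rho_le (f k) i.+1%:R^-1 (u n) l).
case: dm => _ ds _; rewrite lt_max (ds _ l) => /orP[|].
  by rewrite ltNge (ltW ln).
rewrite ltNge (_ : _ <= _)//; apply: le_trans (ltW cV0).
by rewrite subr_le0 (le_trans (lerD fn (ltW ie)))// subrK.
Unshelve. all: by end_near. Qed.

(** The last clause gives convergence in [d'] along an arbitrary filter; a filter on [G * X] then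
    yields continuity of the action. *)
Lemma usc_refinement : exists d' : X -> X -> R, [/\ polish_metric d',
  forall x, dball d x `<=` dball d' x,
  forall k x e, 0 < e -> \forall y \near dball d' x, `|f k x - f k y| < e &
  forall (T : Type) (F : set_system T) (a : T -> X) x, Filter F ->
    (forall e, 0 < e -> \forall t \near F, d x (a t) < e) ->
    (forall k e, 0 < e -> \forall t \near F, `|f k x - f k (a t)| < e) ->
    forall e, 0 < e -> \forall t \near F, d' x (a t) < e].
Proof.
have near2 x : (forall e, 0 < e -> \forall y \near dball d2 x, d x y < e) /\
    (forall k e, 0 < e -> \forall y \near dball d2 x, `|f k x - f k y| < e).
  have ? := dball_filter x d2m.
  have [h1 _] := @near_of_with_functions _ _ _ _ _ (fun=> x) id
    (@dball_near _ _ d2 x).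
  exact: (@near_of_with_functions _ _ _ d f (fun=> x) id h1).
exists d2; split.
- split=> //; first move=> x y xy.
    apply: (polish_sep dP); apply/eqP; rewrite eq_le dge0 andbT.
    apply/ler_addgt0Pr => e e0; rewrite add0r ltW//.
    have [+ _] := near2 x; move=> /(_ _ e0) [s s0]; apply => /=.
    by rewrite xy.
  apply: dcovered_dsup => // -[|n] /=.
    apply: dcovered_dsup => // -[|n] /=; first exact: polish_covered.
    by apply: dcovered_dfun => // r; exact: polish_open dP (@fusc n r).
  apply: dcovered_dfun => [x|r]; last exact: inv_rho_measurable.
  by rewrite /h invr_ge0 ltW// rho_gt0.
- move=> x A [e e0 eA]; have [+ _] := near2 x.
  have ? := dball_filter x d2m.
  by move=> /(_ _ e0); apply: filterS => y /eA.
- by move=> k x; have [_ /(_ k)] := near2 x.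
- by move=> T F a x FF; exact: near_d2.
Qed.

End refinement.

(** A Cauchy sequence for the supremum has a limit for each [D n]; these are all limits for [d0] as
    well, hence coincide. *)
Lemma join_polish_metrics (D : nat -> X -> X -> R) (d0 : X -> X -> R) :
  polish_metric d0 -> (forall n, polish_metric (D n)) ->
  (forall n x, dball d0 x `<=` dball (D n) x) ->
  polish_metric (dsup D) /\ forall n x, dball (D n) x `<=` dball (dsup D) x.
Proof.
move=> d0P DP fin; have Dm n := polish_pmetric (DP n).
have Dsm := pmetric_dsup Dm.
have nearD x n e : 0 < e -> \forall y \near dball (dsup D) x, D n x y < e.
  have ? := dball_filter x Dsm.
  by apply: near_of_dsup; exact: dball_near.
split; last first.
  move=> n x A [e e0 eA]; have ? := dball_filter x Dsm.
  by apply: filterS (nearD x n e e0) => y /eA.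
split=> // [x y xy|u cu|].
- apply: (polish_sep (DP 0%N)); apply/eqP; rewrite eq_le pmetric_ge0// andbT.
  apply/ler_addgt0Pr => e e0; rewrite add0r ltW//.
  by have [s s0] := nearD x 0%N e e0; apply => /=; rewrite xy.
- have cuD := dcauchy_dsup cu.
  have /choice[l ul] n : exists l, dcvg (D n) u l by exact: (polish_complete (DP n)).
  have ul0 n : dcvg d0 u (l n).
    move=> e e0; have [s s0 sP] := fin n (l n) _ (dball_near d0 (l n) e0).
    by apply: filterS (ul n s s0) => k /sP.
  have lE n : l n = l 0%N.
    by apply: (dcvg_unique (polish_pmetric d0P) (polish_sep d0P)); exact: ul0.
  exists (l 0%N); apply: near_dsup => n e e0.
  by have := ul n e e0; rewrite lE.
- by apply: dcovered_dsup => // n; exact: polish_covered.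
Qed.

End polish_metrics.

(** * Topological groups *)

Section right_uniformity.
Local Open Scope group_scope.
Variable G : topologicalGroupType.
Implicit Types (g h : G) (U V : set G).

Lemma mulg_near g h U : nbhs (g * h) U ->
  exists V W, [/\ nbhs g V, nbhs h W & forall a b, V a -> W b -> U (a * b)].
Proof.
move=> /(@mulg_continuous G (g, h)) [[V W] /= [gV hW] VW].
by exists V, W; split=> // a b Va Wb; exact: (VW (a, b)).
Qed.

Lemma continuous_mulgr h : continuous (fun g : G => g * h).
Proof.
move=> g U /mulg_near[V [W [gV hW VW]]].
by apply: filterS gV => a Va; apply: VW => //; exact: nbhs_singleton.
Qed.

Lemma continuous_mulgl h : continuous (fun g : G => h * g).
Proof.
move=> g U /mulg_near[V [W [hV gW VW]]].
by apply: filterS gW => a Wa; apply: VW => //; exact: nbhs_singleton.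
Qed.

(** An alias of the carrier bears the right uniformity, apart from the given topology of [G]. *)
Definition right_uniform : Type := G.
HB.instance Definition _ := Choice.on right_uniform.

Let ent : set_system (right_uniform * right_uniform) :=
  filter_from (nbhs (1 : G)) (fun V => [set p | V ((p.2 : G) * (p.1 : G)^-1)]).

Let ent_filter : Filter ent.
Proof.
apply: filter_from_filter; first by exists setT; exact: filterT.
by move=> V W nV nW; exists (V `&` W) => //; exact: filterI.
Qed.

Let ent_diagonal A : ent A -> diagonal `<=` A.
Proof.
move=> [V V1 VA] [x y] /diagonalP /= ->; apply: VA => /=.
by rewrite mulgV; exact: nbhs_singleton.
Qed.

Let ent_inv A : ent A -> ent A^-1%relation.
Proof.
move=> [V V1 VA]; exists [set g | V g^-1].
  by apply: (@invg_continuous G 1); rewrite invg1.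
by move=> [x y] /= Vxy; apply: VA => /=; rewrite -[_ * _]invgK invgM invgK.
Qed.

Let ent_split A : ent A -> exists2 B, ent B & (B \; B `<=` A)%relation.
Proof.
move=> [V V1 VA].
have [U [W [U1 W1 UW]]] : exists U W,
    [/\ nbhs 1 U, nbhs 1 W & forall a b, U a -> W b -> V (a * b)].
  by apply: mulg_near; rewrite mulg1.
exists [set p | (U `&` W) ((p.2 : G) * (p.1 : G)^-1)].
  by exists (U `&` W) => //; exact: filterI.
move=> [x z] /= [y [_ Wxy] [Uyz _]]; apply: VA => /=.
by have := UW _ _ Uyz Wxy; rewrite mulgA mulgVK.
Qed.

HB.instance Definition _ :=
  isUniform.Build right_uniform ent_filter ent_diagonal ent_inv ent_split.

Lemma right_uniform_countable (V : nat -> set G) :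
  (forall n, nbhs 1 (V n)) -> (forall U, nbhs 1 U -> exists n, V n `<=` U) ->
  countable_uniformity right_uniform.
Proof.
move=> V1 Vbase; apply/countable_uniformityP.
exists (fun n => [set p : right_uniform * right_uniform
  | V n ((p.2 : G) * (p.1 : G)^-1)]).
  by move=> A [U U1 UA]; have [n nU] := Vbase _ U1; exists n => p /nU /UA.
by move=> n; exists (V n).
Qed.

(* Birkhoff-Kakutani: [N r] is the open ball of radius [r] about the identity
   for a right-invariant pseudometric, made invariant by taking the supremum of
   a metric of the right uniformity over all right translations. *)
Lemma right_invariant_balls (R : realType) (V : nat -> set G) :
  (forall n, nbhs 1 (V n)) -> (forall U, nbhs 1 U -> exists n, V n `<=` U) ->
  exists N : R -> set G, [/\ forall r, (0 < r)%R -> N r 1,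
    forall r, open (N r),
    forall U, nbhs 1 U -> exists2 r, (0 < r)%R & N r `<=` U,
    forall r s g h, N r g -> N s h -> N (r + s)%R (g * h) &
    forall r g, N r g -> N r g^-1].
Proof.
move=> V1 Vbase; have cu := right_uniform_countable V1 Vbase.
pose T : pseudoMetricType R := countable_uniform.type cu.
pose M r := [set g : G | forall k : G, @ball R T k r (g * k)].
(* All pairs [(k, g * k)] have the same quotient [g], so one neighbourhood of the identity serves
   every [k]. *)
have M1 r : (0 < r)%R -> nbhs 1 (M r).
  move=> r0; have [U U1 UM] := @entourage_ball R T (PosNum r0).
  apply: filterS U1 => g Ug k; apply: (UM (k, g * k)) => /=.
  by rewrite mulgK.
have MU U : nbhs 1 U -> exists2 r, (0 < r)%R & M r `<=` U.
  move=> U1; have : @entourage T [set p | U ((p.2 : G) * (p.1 : G)^-1)] by exists U.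
  rewrite -entourage_ballE => -[r /= r0 rU]; exists r => // g /(_ 1) /=.
  by move=> /(rU (_, _)) /=; rewrite mulg1 invg1 mulg1.
have MM r s g h : M r g -> M s h -> M (r + s)%R (g * h).
  move=> Mg Mh k; rewrite addrC -mulgA; exact: ball_triangle (Mh k) (Mg (h * k)).
have MV r g : M r g -> M r g^-1.
  by move=> Mg k; apply: ball_sym; have := Mg (g^-1 * k); rewrite mulgA mulgV mul1g.
(* [M r] imposes a condition for every [k] and need not be open; the union over smaller radii is. *)
exists (fun r => \bigcup_(s in [set s | 0 < s < r]%R) M s); split.
- move=> r r0; exists (r / 2)%R => /=; first by apply/andP; split; lra.
  by apply: nbhs_singleton; apply: M1; lra.
- move=> r; rewrite openE => g [s /= /andP[s0 sr] Ms]; rewrite /interior.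
  have : nbhs (g * g^-1) (M ((r - s) / 2)%R) by rewrite mulgV; apply: M1; lra.
  move=> /(@continuous_mulgr g^-1 g) gM.
  have {}gM : nbhs g [set h | M ((r - s) / 2)%R (h * g^-1)] by exact: gM.
  apply: filterS gM => h Mh.
  exists ((r - s) / 2 + s)%R => /=; first by apply/andP; split; lra.
  by rewrite -[h](mulgVK g); exact: MM.
- move=> U /MU[r r0 rU]; exists r => // g [s /= /andP[s0 sr] Ms]; apply: rU => k.
  by apply: le_ball (Ms k); exact: ltW.
- move=> r s g h [r' /= /andP[? ?] ?] [s' /= /andP[? ?] ?].
  by exists (r' + s')%R; [apply/andP; split; lra|exact: MM].
- by move=> r g [s s0 Ms]; exists s => //; exact: MV.
Qed.

End right_uniformity.

(** * Baire category *)

Section category.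
Context {T : topologicalType}.
Implicit Types (A B : set T).

(** Equivalent to a cover by countably many nowhere dense sets; this form meets the Baire theorem
    directly. *)
Definition meager A := exists O : nat -> set T,
  (forall n, open (O n) /\ dense (O n)) /\ A `&` \bigcap_n O n = set0.

Lemma meager_sub A B : A `<=` B -> meager B -> meager A.
Proof.
move=> AB [ O [OP BO]]; exists O; split=> //; apply/seteqP; split=> // x [/AB Bx Ox].
by rewrite -BO.
Qed.

Lemma meager0 : meager set0.
Proof.
exists (fun=> setT); split; last exact: set0I.
by move=> _; split; [exact: openT|move=> U U0 _; rewrite setIT].
Qed.

Lemma meager_bigcup (F : nat -> set T) :
  (forall n, meager (F n)) -> meager (\bigcup_n F n).
Proof.
move=> /choice[ O OP].
(* The double sequence is enumerated by codes of pairs; a number coding no pair harmlessly repeats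
   [O 0 0]. *)
pose p n := odflt (0, 0)%N (unpickle n : option (nat * nat)).
exists (fun n => O (p n).1 (p n).2); split; first by move=> n; case: (OP (p n).1).
apply/seteqP; split=> // x [[i _ Fx] Ox]; have [_ <-] := OP i; split=> // j _.
by have := Ox (pickle (i, j)) I; rewrite /p pickleK.
Qed.

Lemma meagerU A B : meager A -> meager B -> meager (A `|` B).
Proof.
move=> mA mB; rewrite -bigcup2E; apply: meager_bigcup => -[|[|n]] //=.
exact: meager0.
Qed.

Definition Baire_property A :=
  exists O, [/\ open O, meager (A `\` O) & meager (O `\` A)].

Lemma Baire_property_open A : open A -> Baire_property A.
Proof. by move=> Ao; exists A; split=> //; rewrite setDv; exact: meager0. Qed.

Lemma Baire_property_bigcup (F : nat -> set T) :
  (forall n, Baire_property (F n)) -> Baire_property (\bigcup_n F n).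
Proof.
move=> /choice[ O OP]; exists (\bigcup_n O n); split.
- by apply: bigcup_open => n _; case: (OP n).
- apply: (@meager_sub _ (\bigcup_n (F n `\` O n))); last first.
    by apply: meager_bigcup => n; case: (OP n).
  by move=> x [[n _ Fx] nO]; exists n => //; split=> // Ox; apply: nO; exists n.
- apply: (@meager_sub _ (\bigcup_n (O n `\` F n))); last first.
    by apply: meager_bigcup => n; case: (OP n).
  by move=> x [[n _ Ox] nF]; exists n => //; split=> // Fx; apply: nF; exists n.
Qed.

Lemma Baire_property_setC A : Baire_property A -> Baire_property (~` A).
Proof.
move=> [ O [ Oo mAO mOA]]; exists (~` O)°; split; first exact: open_interior.
  apply: (@meager_sub _ ((O `\` A) `|` (~` O `\` (~` O)°))).
    by move=> x [nA nO]; have [Ox|nOx] := pselect (O x); [left|right].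
  apply: meagerU => //; exists (fun=> O `|` (~` O)°); split.
    move=> _; split; first by apply: openU => //; exact: open_interior.
    move=> U [x Ux] Uo; have [[y [Uy Oy]]|UO] := pselect (exists y, U y /\ O y).
      by exists y; split=> //; left.
    exists x; split=> //; right; rewrite /interior.
    apply: filterS (open_nbhs_nbhs (conj Uo Ux)) => y Uy Oy.
    by apply: UO; exists y.
  by apply/seteqP; split=> // x [[nO nI] /(_ 0%N I)[|]].
apply: meager_sub mAO => x [/interior_subset nO nnA]; split=> //.
exact: contrapT.
Qed.

(** If [O] is open and equals [A] up to a meager set, the witness is [O] intersected with [U]; were
    it empty, the part of [A] in [U] would lie in the meager [A \ O]. *)
Lemma Baire_property_nonmeager A U : Baire_property A -> open U ->
  ~ meager (A `&` U) ->
  exists V, [/\ open V, V !=set0, V `<=` U & meager (V `\` A)].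
Proof.
move=> [ O [ Oo mAO mOA]] Uo nm; exists (O `&` U); split.
- exact: openI.
- apply/set0P/eqP => OU; apply: nm; apply: meager_sub mAO => x [Ax Ux].
  by split=> // Ox; suff : set0 x by []; rewrite -OU.
- by move=> x [].
- by apply: meager_sub mOA => x [[]].
Qed.

End category.

(** * Polish spaces and the Baire category theorem *)

Section polish_spaces.
Local Open Scope ring_scope.
Context {R : realType}.

Lemma polish_space_metric (T : topologicalType) : polish R T ->
  exists2 d : T -> T -> R, polish_metric (borel T) d &
    forall x, nbhs x = dball d x.
Proof.
move=> [[D cD dD] [m [Mopen Mcomplete]]]; pose M : metricType R := Metric.Pack m.
pose d : M -> M -> R := @mdist R M.
have dm : pmetric d.
  by split; [exact: mdistxx|exact: metric_sym|move=> x y z; exact: metric_triangle].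
have nbhsMd (x : M) : nbhs x = dball d x.
  by rewrite -metricType_numDomainType.filter_from_mdist_nbhs.
have nbhsd (x : T) : nbhs x = dball d x.
  rewrite -nbhsMd; apply/seteqP; split=> A.
    rewrite nbhsE => -[U [/Mopen Uo Ux] UA].
    by rewrite (@nbhsE M); exists U.
  rewrite (@nbhsE M) => -[U [/Mopen Uo Ux] UA].
  by rewrite nbhsE; exists U.
exists d => //; split=> //.
- exact: (@mdist_positivity R M).
- move=> u cu; have [|l ul] := Mcomplete u.
    apply/cauchy_ballP => e e0; have := cu e e0.
    move=> [[A B] /= [oA oB] AB]; exists (u @` A, u @` B) => /=.
      split; rewrite /nbhs/=/fmap/=; first by apply: filterS oA => n An; exists n.
      by apply: filterS oB => n Bn; exists n.
    move=> [_ _] /= [[i Ai <-] [j Bj <-]]; rewrite ballEmdist /=.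
    exact: (AB (i, j)).
  exists l => e e0; have := ul (ball l e) (nbhsx_ballx l e e0).
  by rewrite ballEmdist.
- apply: dcovered_of_sets; first exact: smallest_sigma_algebra.
  move=> e e0; have [f finj] := (elimT (countable_injP _) cD).
  have e2 : 0 < e / 2 by lra.
  exists (fun n => [set x | exists y, [/\ D y, f y = n & d y x < e / 2]]); split.
  + move=> n; apply: sub_sigma_algebra; rewrite openE => x [y [Dy fy yx]].
    rewrite /interior nbhsd; have := @dball_open _ _ d y (e / 2) dm x yx.
    have ? := dball_filter x dm.
    by apply: filterS => z yz; exists y.
  + move=> x; have [y [/= xy Dy]] : [set y | d x y < e / 2] `&` D !=set0.
      apply: dD; first by exists x => /=; case: dm => ->.
      by rewrite openE => y xy; rewrite /interior nbhsd; exact: dball_open.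
    by exists (f y), y; split=> //; case: dm => _ ->.
  + move=> _ x x' [y [Dy <- yx]] [y' [Dy' ff yx']].
    have yy : y' = y by apply: finj; rewrite ?inE.
    move: yx'; rewrite yy => yx'; case: dm => _ ds dt.
    by have := dt x y x'; rewrite (ds x y); lra.
Qed.

Lemma separable_sequence (T : topologicalType) (t : T) : separable T ->
  exists s : nat -> T, forall U, open U -> U !=set0 -> exists n, U (s n).
Proof.
move=> [D cD dD]; have [Dn0|/unsquash s] := elimT pfcard_geP cD.
  have [x] : [set: T] `&` D !=set0 by apply: dD; [exists t|exact: openT].
  by rewrite Dn0 => -[].
exists s => U Uo Un0; have [x [Ux Dx]] := dD U Un0 Uo.
by have [n _ sn] := @surj _ _ _ _ s x Dx; exists n; rewrite sn.
Qed.

(** The centres of nested balls, the [n]-th step entering [O n] with radius below [1 / (n + 1)],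
    converge to a common point. Closed balls are used since the limit satisfies only weak
    inequalities. *)
Lemma dcomplete_Baire (T : topologicalType) (d : T -> T -> R) :
  pmetric d -> dcomplete d -> (forall x, nbhs x = dball d x) ->
  forall O : nat -> set T, (forall n, open (O n) /\ dense (O n)) ->
    dense (\bigcap_n O n).
Proof.
move=> dm dc nbhsd O OP D [x0 Dx0] Do.
have ballo x r : open [set y | d x y < r].
  by rewrite openE => y xy; rewrite /interior nbhsd; exact: dball_open.
have dxx x : d x x = 0 by case: dm.
have shrink x (U : set T) n : open U -> U x -> exists s, [/\ 0 < s,
    s < n.+1%:R^-1 & forall z, d x z <= s -> U z].
  rewrite openE => /[apply]; rewrite /interior nbhsd => -[e e0 eU].
  have : 0 < n.+1%:R^-1 :> R by []; move: (n.+1%:R^-1) => v v0.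
  have m0 : 0 < Num.min e v by rewrite lt_min e0.
  have me : Num.min e v <= e by rewrite ge_min lexx.
  have mv : Num.min e v <= v by rewrite ge_min lexx orbT.
  exists (Num.min e v / 2); move: (Num.min e v) m0 me mv => m m0 me mv.
  by split=> [||z xz]; [lra|lra|apply: eU => /=; lra].
have /choice[f fP] : forall nxr : nat * (T * R), exists ys : T * R,
    0 < nxr.2.2 -> [/\ 0 < ys.2, ys.2 < nxr.1.+1%:R^-1 &
      forall z, d ys.1 z <= ys.2 -> d nxr.2.1 z < nxr.2.2 /\ O nxr.1 z].
  move=> [n [x r]] /=; have [r0|/negP r0] := boolP (0 < r); last by exists (x, r).
  have [y [xy Oy]] : [set y | d x y < r] `&` O n !=set0.
    by apply: (OP n).2 => //; exists x; rewrite /= dxx.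
  have [|s [s0 sn sP]] := @shrink y ([set y | d x y < r] `&` O n) n _ (conj xy Oy).
    by apply: openI => //; case: (OP n).
  by exists (y, s) => _; split=> // z /sP.
have [r0 [r00 _ r0D]] := shrink x0 D 0%N Do Dx0.
pose fix a n := if n is k.+1 then f (k, a k) else (x0, r0).
have a0 n : 0 < (a n).2 by elim: n => //= n IH; case: (fP (n, a n) IH).
have aS n z : d (a n.+1).1 z <= (a n.+1).2 -> d (a n).1 z < (a n).2 /\ O n z.
  by case: (fP (n, a n) (a0 n)) => _ _; apply.
have aD n k z : d (a (k + n)%N).1 z < (a (k + n)%N).2 -> d (a n).1 z < (a n).2.
  by elim: k => // k IH; rewrite addSn => /ltW /aS[/IH].
have ale n m : (n <= m)%N -> d (a n).1 (a m).1 < (a n).2.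
  by move=> nm; apply: (aD n (m - n)%N); rewrite subnK// dxx.
case: dm (dm) => _ ds dt dm.
have [l al] : exists l, dcvg d (fun n => (a n).1) l.
  apply: dc => e e0.
  have [n ne] : exists n : nat, n.+1%:R^-1 < e / 2.
    exists (Num.truncn (e / 2)^-1).
    by rewrite -ltf_pV2 ?(posrE,divr_gt0)// ?invrK ?truncnS_gt//; lra.
  exists ([set m | (n < m)%N], [set m | (n < m)%N]) => /=.
    by split; exists n.+1.
  move=> [i j] /= [ni nj]; have [_ an _] := fP (n, a n) (a0 n).
  have := ale n.+1 i ni; have := ale n.+1 j nj.
  have := dt (a i).1 (a n.+1).1 (a j).1; rewrite (ds (a i).1 (a n.+1).1).
  have {}an := lt_trans an ne; move: an => /=; lra.
have all n : d (a n).1 l <= (a n).2.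
  apply/ler_addgt0Pr => e e0.
  have [m [nm lm]] : exists m, (n <= m)%N /\ d l (a m).1 < e.
    apply: (@filter_ex _ \oo); apply: filterI; last exact: al.
    exact: nbhs_infty_ge.
  have := dt (a n).1 (a m).1 l; rewrite (ds (a m).1 l); have := ale n m nm; lra.
exists l; split; first exact/r0D/(all 0%N).
by move=> n _; have [] := aS n l (all n.+1).
Qed.

Lemma nonmeager_open (T : topologicalType) (U : set T) : polish R T ->
  open U -> U !=set0 -> ~ meager U.
Proof.
move=> /polish_space_metric[d [dm _ dc _] nbhsd] Uo U0 [ O [ OP UO]].
have [x Ux] := dcomplete_Baire dm dc nbhsd OP U0 Uo.
by suff : set0 x by []; rewrite -UO.
Qed.

End polish_spaces.

(** * The topological space of a Polish metric *)

Section metrized.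
Local Open Scope ring_scope.
Context {R : realType} {X : choiceType} (d : X -> X -> R).

(** The proofs are parameters of the alias, so that the metric instance can read them off the
    type. *)
Definition metrized (dm : pmetric d) (dsep : forall x y, d x y = 0 -> x = y) : Type :=
  X.

Variables (dm : pmetric d) (dsep : forall x y, d x y = 0 -> x = y).

HB.instance Definition _ := Choice.on (metrized dm dsep).

Let dxx x : d x x = 0. Proof. by case: dm. Qed.
Let dsym x y : d x y = d y x. Proof. by case: dm. Qed.
Let dtri y x z : d x z <= d x y + d y z. Proof. by case: dm. Qed.

HB.instance Definition _ :=
  isMetric.Build R (metrized dm dsep) dxx dsep dsym dtri.

Lemma nbhs_metrized (x : metrized dm dsep) : nbhs x = dball d x.
Proof. by rewrite -metricType_numDomainType.filter_from_mdist_nbhs. Qed.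

Lemma open_metrized (U : set (metrized dm dsep)) : open U <-> dopen d U.
Proof. by rewrite openE; split=> Uo x /Uo; rewrite /interior nbhs_metrized. Qed.

Lemma polish_metrized (S : set (set X)) : sigma_algebra setT S ->
  polish_metric S d -> polish R (metrized dm dsep).
Proof.
move=> SS [_ _ dc dcov]; split; last first.
  exists (Metric.class (metrized dm dsep)); split=> // u cu.
  have [|l ul] := dc u.
    move=> e e0; have /cauchy_ballP/(_ e e0) := cu.
    move=> [[A B] /= [oA oB] AB]; exists (u @^-1` A, u @^-1` B) => //=.
    by move=> [i j] /= [Ai Bj]; have := AB (u i, u j) (conj Ai Bj); rewrite ballEmdist.
  exists l => A; rewrite nbhs_metrized => -[e e0 eA].
  by apply: filterS (ul e e0) => n /eA.
have /choice[c cP] : forall j : nat, exists c : X -> nat,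
    forall x y, c x = c y -> d x y < j.+1%:R^-1.
  by move=> j; have [//|c [_ ?]] := dcov j.+1%:R^-1; exists c.
(* A point chosen in piece [n] of partition [j], or [None] if that piece is empty; these points form
   the dense set. *)
pose s (jn : nat * nat) : option X :=
  if pselect (exists y, c jn.1 y = jn.2) is left ex then Some (projT1 (cid ex))
  else None.
exists [set x : X | exists jn, s jn = Some x].
  apply/countable_injP.
  exists (fun x => pickle (get [set jn | s jn = Some x])) => x y.
  rewrite !inE => -[i ix] [j jy] /(pcan_inj pickleK) ij.
  have : s (get [set jn | s jn = Some x]) = Some x
    by exact: (@getI _ [set jn | s jn = Some x] i).
  have : s (get [set jn | s jn = Some y]) = Some y
    by exact: (@getI _ [set jn | s jn = Some y] j).
  by rewrite -ij => -> [].
move=> U [x Ux] /open_metrized/(_ x Ux)[e /= e0 eU].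
have [j je] : exists j : nat, j.+1%:R^-1 < e.
  exists (Num.truncn e^-1).
  by rewrite -ltf_pV2 ?(posrE,divr_gt0)// invrK truncnS_gt.
have : s (j, c j x) != None.
  by rewrite /s /=; case: pselect => //= -[]; exists x.
case E : (s (j, c j x)) => [y|] // _; exists y; split; last by exists (j, c j x).
apply: eU => /=; apply: lt_trans je; apply: cP.
by move: E; rewrite /s /=; case: pselect => //= ex [<-]; case: cid => /= z ->.
Qed.

End metrized.

Lemma meager_mulgr (G : topologicalGroupType) (A : set G) (h : G) :
  meager A -> meager [set g | A (g * h)%g].
Proof.
move=> [ O [ OP AO]]; exists (fun n => [set g | O n (g * h)%g]); split; last first.
  apply/seteqP; split=> // g [Ag Og].
  by suff : set0 (g * h)%g by []; rewrite -AO; split=> // n _; exact: Og.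
move=> n; have [ Oo Od] := OP n; split.
  exact: (iffLR (continuousP _) (@continuous_mulgr G h)).
move=> U [g Ug] Uo; have [||k [/= Uk Ok]] := Od [set k | U (k * h^-1)%g].
- by exists (g * h)%g => /=; rewrite mulgK.
- exact: (iffLR (continuousP _) (@continuous_mulgr G h^-1%g)).
- by exists (k * h^-1)%g; split=> //=; rewrite mulgVK.
Qed.

(** * Vaught transforms *)

Section becker_kechris.
Local Open Scope ring_scope.
Context {R : realType} {G : topologicalGroupType} {X : topologicalType}.
Variable act : G -> X -> X.
Hypotheses (polishG : polish R G) (GX : polish_Gspace R act).
Implicit Types (B : set X) (U : set G) (d : X -> X -> R).

(* The Vaught transform, usually written with [U] in the exponent after a
   triangle. *)
Definition vaught B U : set X :=
  [set x | ~ meager [set g | U g /\ B (act g x)]].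

Definition orbit_Baire B := forall x, Baire_property [set g | B (act g x)].

Lemma vaught_sub B U V x : U `<=` V -> vaught B U x -> vaught B V x.
Proof.
move=> UV BU mV; apply: BU; apply: meager_sub mV => g [Ug Bg].
by split=> //; exact: UV.
Qed.

Lemma vaught_bigcup (B : (set X)^nat) U :
  vaught (\bigcup_n B n) U = \bigcup_n vaught (B n) U.
Proof.
apply/seteqP; split=> x; last first.
  move=> [n _ Bn] m; apply: Bn; apply: meager_sub m => g [Ug Bg].
  by split=> //; exists n.
move=> BU; apply: contrapT => nB; apply: BU.
apply: (@meager_sub _ _ (\bigcup_n [set g | U g /\ B n (act g x)])).
  by move=> g [Ug [n _ Bg]]; exists n.
apply: meager_bigcup => n; apply: contrapT => nm; apply: nB; by exists n.
Qed.

(** For invariant [B] the set of [g] with [act g x] in [B] is empty or all of [G], and [G] is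
    nonmeager by the Baire theorem. *)
Lemma vaught_invariant B : invariant_set act B -> vaught B setT = B.
Proof.
move=> Binv; apply/seteqP; split=> x.
  move=> Bx; apply: contrapT => nBx; apply: Bx.
  apply: (@meager_sub _ _ set0); last exact: meager0.
  move=> g [_ /(Binv g^-1%g)]; rewrite -(Gspace_actM GX) mulVg (Gspace_act1 GX).
  exact: nBx.
move=> Bx m; apply: (nonmeager_open polishG openT); first by exists 1%g.
by apply: meager_sub m => g _; split=> //; exact: Binv.
Qed.

Lemma act_near g x (A : set X) : nbhs (act g x) A ->
  exists V W, [/\ nbhs g V, nbhs x W & forall h y, V h -> W y -> A (act h y)].
Proof.
move=> /(@Gspace_continuous _ _ _ _ GX (g, x)) [[V W] /= [gV xW] VW].
by exists V, W; split=> // h y Vh Wy; exact: (VW (h, y)).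
Qed.

Lemma open_orbit B x : open B -> open [set g | B (act g x)].
Proof.
rewrite !openE => Bo g /= /Bo /act_near[V [W [gV xW VW]]].
by apply: filterS gV => h Vh; apply: VW => //; exact: nbhs_singleton.
Qed.

(** The set whose nonmeagerness is asked is open here, so being nonmeager amounts to being
    nonempty. *)
Lemma vaught_open B U : open B -> open U -> open (vaught B U).
Proof.
move=> Bo Uo.
suff -> : vaught B U = [set x | exists2 g, U g & B (act g x)].
  move: Bo; rewrite !openE => Bo x /= [g Ug /Bo /act_near[V [W [gV xW VW]]]].
  apply: filterS xW => y Wy; exists g => //; apply: VW => //.
  exact: nbhs_singleton.
apply/seteqP; split=> x.
  move=> BU; apply: contrapT => nB; apply: BU.
  apply: (@meager_sub _ _ set0); last exact: meager0.
  by move=> g [Ug Bg]; apply: nB; exists g.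
move=> [g Ug Bg]; apply: (nonmeager_open polishG); last by exists g.
by apply: openI => //; exact: open_orbit.
Qed.

Lemma orbit_BaireP B : borel X B -> orbit_Baire B.
Proof.
move: B; apply: smallest_sub; last first.
  by move=> B Bo x; apply: Baire_property_open; exact: open_orbit.
split.
- by move=> x; apply: Baire_property_open; exact: open0.
- move=> B BP x; rewrite setTD; exact: Baire_property_setC (BP x).
- move=> B BP x.
  rewrite (_ : [set g | _] = \bigcup_n [set g | B n (act g x)]).
    by apply: Baire_property_bigcup => n; exact: BP.
  by apply/seteqP; split=> g [n _ Bg]; exists n.
Qed.

Variable d0 : X -> X -> R.
Hypotheses (d0P : polish_metric (borel X) d0) (d0E : forall x, nbhs x = dball d0 x).

(** Encodes a finer Polish topology with continuous action; the partitions into sets of [borel X]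
    exclude new Borel sets. *)
Record compatible_metric d : Prop := CompatibleMetric {
  compatible_polish : polish_metric (borel X) d ;
  compatible_finer : forall x, dball d0 x `<=` dball d x ;
  compatible_act : forall g x e, 0 < e ->
    \forall p \near filter_prod (nbhs g) (dball d x), d (act g x) (act p.1 p.2) < e }.

Lemma compatible_d0 : compatible_metric d0.
Proof.
split=> [//|x A //|g x e e0]; rewrite -d0E.
have : nbhs (act g x) [set y | d0 (act g x) y < e] by rewrite d0E; exists e.
by move/(@Gspace_continuous _ _ _ _ GX (g, x)).
Qed.

Lemma join_compatible_metrics (D : nat -> X -> X -> R) :
  (forall n, compatible_metric (D n)) ->
  exists2 d, compatible_metric d & forall n x, dball (D n) x `<=` dball d x.
Proof.
move=> DP; have [||n|n x|dP dfin] := @join_polish_metrics _ _ (borel X) _ D d0.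
- exact: smallest_sigma_algebra.
- exact: d0P.
- exact: compatible_polish.
- exact: compatible_finer.
exists (dsup D) => //; split=> // [x A /(compatible_finer (DP 0%N))|g x].
  exact: dfin.
have ? := dball_filter x (polish_pmetric dP).
apply: (@near_dsup _ _ _ _ _ _ (fun=> act g x) (fun p => act p.1 p.2)) => n e e0.
have [[A B] /= [gA xB] AB] := compatible_act (DP n) g x e0.
by exists (A, B) => //; split=> //; exact: dfin xB.
Qed.

Definition topologizable B := exists2 d, compatible_metric d &
  forall U, open U -> dopen d (vaught B U).

Lemma topologizable_open B : open B -> topologizable B.
Proof.
move=> Bo; exists d0; first exact: compatible_d0.
move=> U Uo x xBU; rewrite -d0E; apply: open_nbhs_nbhs; split=> //.
exact: vaught_open.
Qed.

Lemma topologizable_bigcup (B : (set X)^nat) :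
  (forall n, topologizable (B n)) -> topologizable (\bigcup_n B n).
Proof.
move=> BP; have /choice[D DP] : forall n, exists d, compatible_metric d /\
    forall U, open U -> dopen d (vaught (B n) U).
  by move=> n; have [d] := BP n; exists d.
have [|d dP Dd] := @join_compatible_metrics D; first by move=> n; case: (DP n).
exists d => // U Uo x; rewrite vaught_bigcup => -[n _ xB].
have ? := dball_filter x (polish_pmetric (compatible_polish dP)).
have := Dd n x _ ((DP n).2 U Uo x xB).
by apply: filterS => y yB; exists n.
Qed.

(** * Complements of topologizable sets *)

Section complement.
Variable N : R -> set G.
Hypotheses (N1 : forall r, 0 < r -> N r 1%g) (Nopen : forall r, open (N r)).
Hypothesis Nbase : forall U, nbhs 1%g U -> exists2 r, 0 < r & N r `<=` U.
Hypothesis NM : forall r s g h, N r g -> N s h -> N (r + s) (g * h)%g.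
Hypothesis NV : forall r g, N r g -> N r g^-1%g.

(** Balls of the right-invariant pseudometric: translation by [k] on the right carries [ball_ g r]
    onto [ball_ (g * k) r]. *)
Let ball_ (g : G) (r : R) : set G := [set h | N r (h * g^-1)%g].

Let ball_open g r : open (ball_ g r).
Proof. exact: (iffLR (continuousP _) (@continuous_mulgr G g^-1%g)). Qed.

Let ballxx g r : 0 < r -> ball_ g r g.
Proof. by move=> r0; rewrite /ball_ /= mulgV; exact: N1. Qed.

Let ball_nbhs g r : 0 < r -> nbhs g (ball_ g r).
Proof. by move=> r0; apply: open_nbhs_nbhs; split=> //; exact: ballxx. Qed.

Let ball_sym g h r : ball_ g r h -> ball_ h r g.
Proof. by move=> /NV; rewrite /ball_ /= invgM invgK. Qed.

Let ball_triangle g h k r s : ball_ g r h -> ball_ h s k -> ball_ g (s + r) k.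
Proof. by move=> gh hk; have := NM hk gh; rewrite mulgA mulgVK. Qed.

Let ball_le g r s : r <= s -> ball_ g r `<=` ball_ g s.
Proof.
rewrite le_eqVlt => /orP[/eqP->//|rs] h gh; rewrite -(subrK r s).
by apply: ball_triangle gh _; apply: ballxx; rewrite subr_gt0.
Qed.

Let ball_base g U : nbhs g U -> exists2 r, 0 < r & ball_ g r `<=` U.
Proof.
rewrite -[g in nbhs g]mul1g => /(@continuous_mulgr G g 1%g) /Nbase[r r0 rU].
by exists r => // h /rU /=; rewrite mulgVK.
Qed.

Variable B : set X.

(* The distance, truncated at [1], from [g] to the set of points at which
   [{h | act h x \in B}] is locally nonmeager. *)
Let dist (x : X) (g : G) : R :=
  inf ([set 1] `|` [set r | 0 < r /\ vaught B (ball_ g r) x]).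

Let dist_le x g r : 0 < r -> vaught B (ball_ g r) x -> dist x g <= r.
Proof.
move=> r0 xB; apply: ge_inf; last by right.
by exists 0 => s [->//|[s0 _]]; exact: ltW.
Qed.

Let dist_le1 x g : dist x g <= 1.
Proof.
by apply: ge_inf; [exists 0 => s [->//|[s0 _]]; exact: ltW|left].
Qed.

Let le_dist x g r : r <= 1 ->
  (forall s, 0 < s -> vaught B (ball_ g s) x -> r <= s) -> r <= dist x g.
Proof.
move=> r1 h; apply: lb_le_inf; first by exists 1; left.
by move=> s [->//|[s0 xs]]; exact: h.
Qed.

Let dist_ge0 x g : 0 <= dist x g.
Proof. by apply: le_dist => // s s0 _; exact: ltW. Qed.

Let dist_lt x g r : dist x g < r ->
  1 < r \/ exists s, [/\ 0 < s, s < r & vaught B (ball_ g s) x].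
Proof.
move=> xr; have [r1|r1] := ltP 1 r; [by left|right].
apply: contrapT => /forallNP h; move: xr; apply/negP; rewrite -leNgt.
apply: le_dist => // s s0 xs; rewrite leNgt; apply/negP => sr.
exact: (h s).
Qed.

(** The ball of radius [s + r] about one point contains the ball of radius [s] about the other, and
    transforms grow with [U]. *)
Let dist_lip x g h r : 0 < r -> ball_ g r h -> `|dist x g - dist x h| <= r.
Proof.
move=> r0; have H a b : ball_ a r b -> dist x a <= dist x b + r.
  move=> ab; rewrite -lerBlDr; apply: le_dist => [|s s0 xs].
    by have := dist_le1 x a; lra.
  rewrite lerBlDr; apply: dist_le; first by lra.
  by apply: vaught_sub xs => k; exact: ball_triangle.
by move=> gh; have := H _ _ gh; have := H _ _ (ball_sym gh); rewrite ler_norml; lra.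
Qed.

(** Right translation by [h] preserves meagerness and, by right invariance, carries balls to
    balls. *)
Let vaught_act x g h r :
  vaught B (ball_ g r) (act h x) <-> vaught B (ball_ (g * h)%g r) x.
Proof.
split; apply: contra_not => /meager_mulgr.
- move=> /(_ h); apply: meager_sub => k [/= gk Bk].
  by rewrite (Gspace_actM GX) /ball_ /= invgM mulgA mulgK.
- move=> /(_ h^-1%g); apply: meager_sub => k [/= gk Bk].
  by rewrite -(Gspace_actM GX) mulgVK /ball_ /= -mulgA -invgM.
Qed.

Let dist_act x g h : dist (act h x) g = dist x (g * h)%g.
Proof.
rewrite /dist; congr (inf (_ `|` _)).
by apply/seteqP; split=> r [r0 /vaught_act].
Qed.

(** Forward, the Baire property yields a ball inside [U] in which [B] is meager along the orbit, so
    its centre has positive distance. Backward, [B] is meager in the ball of radius [dist x g / 2];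
    were its complement meager in [U], a nonempty open set would be meager. *)
Let vaught_setC U x : orbit_Baire B -> open U ->
  vaught (~` B) U x <-> exists2 g, U g & 0 < dist x g.
Proof.
move=> BP Uo; split=> [xU|[g Ug xg]].
  have [|||V [Vo [g Vg] VU mV]] :=
    @Baire_property_nonmeager _ [set g | ~ B (act g x)] U.
  - exact: Baire_property_setC (BP x).
  - exact: Uo.
  - by move=> m; apply: xU; apply: meager_sub m => g [].
  exists g; first exact: VU.
  have [r r0 rV] := ball_base (open_nbhs_nbhs (conj Vo Vg)).
  apply: (@lt_le_trans _ _ (Num.min r 1)); first by rewrite lt_min r0 ltr01.
  apply: le_dist; first by rewrite ge_min lexx orbT.
  move=> s s0 xs; rewrite leNgt; apply/negP; rewrite lt_min => /andP[sr _].
  apply: xs; apply: meager_sub mV => k [/= gk Bk]; split; last by [].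
  by apply: rV; apply: ball_le gk; exact: ltW.
have mB : meager [set h | ball_ g (dist x g / 2) h /\ B (act h x)].
  apply: contrapT => nm; have : dist x g <= dist x g / 2.
    by apply: dist_le => //; lra.
  by lra.
move=> mU; have [] := @nonmeager_open R _ (U `&` ball_ g (dist x g / 2)) polishG.
- by apply: openI => //; exact: ball_open.
- by exists g; split=> //; apply: ballxx; lra.
apply: meager_sub (meagerU mU mB) => h [Uh gh].
by have [Bh|nBh] := pselect (B (act h x)); [right|left].
Qed.

Lemma topologizable_setC_balls : orbit_Baire B -> topologizable B ->
  topologizable (~` B).
Proof.
move=> BP [d dP dB]; have dpm := compatible_polish dP.
have [s sdense] := @separable_sequence G 1%g polishG.1.
have sapprox g r : 0 < r -> exists n, ball_ g r (s n).
  by move=> r0; apply: sdense; [exact: ball_open|exists g; exact: ballxx].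
have [||||d' [d'P d'fin d's d'near]] :=
    @usc_refinement R X (borel X) _ d (fun n x => dist x (s n)).
- exact: smallest_sigma_algebra.
- exact: dpm.
- by move=> n x; exact: dist_ge0.
- move=> n r x /=; have ? := dball_filter x (polish_pmetric dpm).
  move=> /dist_lt[r1|[t [t0 tr xt]]].
    by apply: filterS filterT => y _; exact: le_lt_trans (dist_le1 _ _) r1.
  have := dB _ (ball_open (s n) t) x xt; apply: filterS => y yt.
  exact: le_lt_trans (dist_le t0 yt) tr.
have d'F x := dball_filter x (polish_pmetric d'P).
(* Continuity passes from the dense points [s n] to every [g] because [dist] is Lipschitz in [g],
   uniformly in the point of [X]. *)
have d'dist g x e : 0 < e -> \forall y \near dball d' x, `|dist x g - dist y g| < e.
  move=> e0; have e4 : 0 < e / 4 by lra.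
  have [n gn] := sapprox g _ e4.
  apply: filterS (d's n x _ e4) => y; rewrite !ltr_norml.
  have := dist_lip x e4 gn; have := dist_lip y e4 gn.
  by rewrite !ler_norml; lra.
exists d'.
  split=> // [x A /(compatible_finer dP)|g x]; first exact: d'fin.
  apply: (d'near _ _ (fun p => act p.1 p.2)) => [e e0|n e e0].
    have [[A C] /= [gA xC] AC] := compatible_act dP g x e0.
    by exists (A, C) => //; split=> //; exact: d'fin xC.
  have e2 : 0 < e / 2 by lra.
  (* [dist (act h y) (s n)] equals [dist y (s n * h)]: the first set moves [s n * h] to [s n * g],
     the second moves [y] to [x]. Since [s n * g] need not be in the dense sequence, [d'dist] is
     applied. *)
  exists ([set h | ball_ (s n * g)%g (e / 2) (s n * h)%g],
      [set y | `|dist x (s n * g)%g - dist y (s n * g)%g| < e / 2]) => /=.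
    split; last exact: d'dist.
    exact: (@continuous_mulgl G (s n) g _ (ball_nbhs _ e2)).
  move=> [h y] /= [gh xy]; rewrite !dist_act.
  have := dist_lip y e2 gh; move: xy; rewrite !ltr_norml ler_norml; lra.
move=> U Uo x /(vaught_setC _ BP Uo)[g Ug xg].
(* Within [dist x g / 2] of [g] the distance stays positive, so [g] may be replaced by a dense point
   of [U]. *)
have [n [Un xn]] : exists n, U (s n) /\ 0 < dist x (s n).
  have h0 : 0 < dist x g / 2 by rewrite divr_gt0.
  have [||n [Un gn]] := sdense (U `&` ball_ g (dist x g / 2)).
  - by apply: openI => //; exact: ball_open.
  - by exists g; split=> //; exact: ballxx.
  exists n; split=> //; have := dist_lip x h0 gn.
  by rewrite ler_norml => /andP[_]; rewrite lerBlDr; lra.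
apply: filterS (d's n x _ xn) => y xy; apply/(vaught_setC _ BP Uo).
by exists (s n) => //; move: xy; rewrite ltr_norml; lra.
Qed.

End complement.

Lemma topologizable_setC B : orbit_Baire B -> topologizable B ->
  topologizable (~` B).
Proof.
have [dG [dGm _ _ _] dGE] := polish_space_metric polishG.
pose V n : set G := [set g | dG 1%g g < n.+1%:R^-1].
have [n|U|N [N1 No Nb NM NV]] := @right_invariant_balls G R V.
- by rewrite dGE; exists n.+1%:R^-1 => /=.
- rewrite dGE => -[e e0 eU]; exists (Num.truncn e^-1) => g ge; apply: eU => /=.
  apply: lt_trans ge _.
  by rewrite -ltf_pV2 ?(posrE,divr_gt0)// invrK truncnS_gt.
exact: topologizable_setC_balls N1 No Nb NM NV B.
Qed.

Lemma topologizable_borel B : borel X B -> topologizable B.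
Proof.
move=> bB; suff : [set A | borel X A /\ topologizable A] B by case.
move: B bB; apply: smallest_sub; last first.
  by move=> B Bo; split; [exact: sub_sigma_algebra|exact: topologizable_open].
split.
- by split; [exact: sigma_algebra0|exact: topologizable_open open0].
- move=> B [bB tB]; split; first exact: sigma_algebraCD.
  by rewrite setTD; apply: topologizable_setC => //; exact: orbit_BaireP.
- move=> B BP; split; first by apply: sigma_algebra_bigcup => n; case: (BP n).
  by apply: topologizable_bigcup => n; case: (BP n).
Qed.

(** Both [B] and its complement are invariant, hence equal to their own transforms by [G]; the
    metrics that topologize them are joined. *)
Lemma clopen_metric B : borel X B -> invariant_set act B ->
  exists d, [/\ compatible_metric d, dopen d B & dopen d (~` B)].
Proof.
move=> bB Binv; have CBinv : invariant_set act (~` B).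
  move=> g x nBx /(Binv g^-1%g); rewrite -(Gspace_actM GX) mulVg.
  by rewrite (Gspace_act1 GX).
have [d1 d1P d1B] := topologizable_borel bB.
have bCB : borel X (~` B) by rewrite -setTD; exact: sigma_algebraCD.
have [d2 d2P d2B] := topologizable_borel bCB.
have [[|n]//|d dP Dd] := @join_compatible_metrics (fun n => if n is 0%N then d1 else d2).
exists d; split=> // x Bx.
- apply: (Dd 0%N); move: x Bx; have := d1B _ openT.
  by rewrite vaught_invariant.
- apply: (Dd 1%N); move: x Bx; have := d2B _ openT.
  by rewrite vaught_invariant.
Qed.

End becker_kechris.

Theorem theorem1p2 (R : realType) (G : topologicalGroupType)
    (X : topologicalType) (act : G -> X -> X) (B : set X)
    (polishG : polish R G) (GX : polish_Gspace R act)
    (invB : invariant_set act B) (borelB : borel X B) :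
  exists tau : Topological.axioms_ X,
    let X' : topologicalType := Topological.Pack tau in
    [/\ polish R X',
        (forall U : set X, @open X U -> @open X' U),
        borel X' = borel X,
        @clopen X' B
      & @polish_Gspace R G X' act].
Proof.
have [d0 d0P d0E] := polish_space_metric (Gspace_polish GX).
have [d [dP dB dCB]] := clopen_metric polishG GX d0P d0E borelB invB.
have [dpol dfin dact] := dP.
pose T : topologicalType := metrized (polish_pmetric dpol) (polish_sep dpol).
have SX : sigma_algebra setT (borel X) by exact: smallest_sigma_algebra.
have Tpolish : polish R T by exact: polish_metrized SX dpol.
have openTE (U : set X) : @open T U <-> dopen d U by exact: open_metrized.
have XT (U : set X) : @open X U -> @open T U.
  move=> Uo; apply/openTE => x Ux; apply: dfin.
  by rewrite -d0E; exact: open_nbhs_nbhs.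
exists (Topological.class T); split=> //.
(* The partitions for [d] consist of sets in [borel X], so every [d]-open set is already Borel in
   the old topology. *)
- apply/seteqP; split; last exact: sub_sigma_algebra2.
  apply: smallest_sub; first exact: smallest_sigma_algebra.
  by move=> U /openTE; exact: (polish_open SX dpol).
- by split; [exact/openTE|rewrite -openC; exact/openTE].
split=> //; [exact: (Gspace_act1 GX)|exact: (Gspace_actM GX)|].
move=> [g x] A /=; rewrite (nbhs_metrized (act g x : T)) => -[e e0 eA].
have [[V W] /= [gV xW] VW] := dact g x e e0.
exists (V, W) => /=; last by move=> p /VW /eA.
by split=> //; rewrite (nbhs_metrized (x : T)).
Qed.
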